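(* Let $G=(V,E)$ be a finite connected weighted graph, let $b,c:V\to\mathbb{R}$ with $b(x)\ge 0$ on $V$, and let $f:V\times\mathbb{R}\to\mathbb{R}$. Consider the equation $$-\Delta_V u-\vec{b}\cdot\nabla u+c(x)u=f(x,u),\quad x\in V.\quad (P)$$ Let $\overline{u}$ and $\underline{u}$ be an upper and a lower solution of (P), respectively, with $\underline{u}\le\overline{u}$ on $V$, and set $\underline{c}=\min_V\underline{u}$, $\overline{c}=\max_V\overline{u}$. Suppose there is a constant $M'>0$ such that $$|f(x,u)-f(x,v)|\le M'|u-v|\quad\text{for all }x\in V,\ u,v\in[\underline{c},\overline{c}].$$ Then there exist sequences $\{\underline{u}_m\}_{m\ge1}$ and $\{\overline{u}_m\}_{m\ge1}$ of functions on $V$ such that $\{\underline{u}_m\}$ is monotone nondecreasing in $m$, $\{\overline{u}_m\}$ is monotone nonincreasing in $m$, $\underline{u}\le\underline{u}_m\le\overline{u}_m\le\overline{u}$ for all $m\ge 1$, and $\underline{u}_m\to\tilde{u}$, $\overline{u}_m\to\hat{u}$ as $m\to+\infty$, where $\tilde{u}$ and $\hat{u}$ are solutions of (P) that are minimal and maximal in the following sense: if $u$ is a solution of (P) satisfying $\underline{u}\le u\le\overline{u}$ on $V$, then $\tilde{u}\le u\le\hat{u}$ on $V$.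
   Context: $G=(V,E)$ is a finite, undirected, connected graph with a weight $\omega:V\times V\to[0,\infty)$, $\omega_{xy}=\omega_{yx}$, $\omega_{xy}=0$ if and only if $xy\notin E$, and a measure $\mu:V\to(0,\infty)$. The graph Laplacian is $\Delta_V u(x)=\sum_{y\in V}(u(y)-u(x))\frac{\omega_{yx}}{\mu(x)}$. With $\vec b=(b(x))_{x\in V}$ and $\nabla u(x)=\big((u(y)-u(x))\sqrt{\omega_{xy}/(2\mu(x))}\big)_{y\sim x}$, one sets $(\vec b\cdot\nabla u)(x)=\sum_{y\sim x}b(y)(u(y)-u(x))\sqrt{\frac{\omega_{xy}}{2\mu(x)}}$. An upper (respectively lower) solution of (P) is a function $u:V\to\mathbb{R}$ with $-\Delta_V u-\vec{b}\cdot\nabla u+c(x)u\ge(\le)\,f(x,u)$ for all $x\in V$. *)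

(* Defs.v *)
From HB Require Import structures.
From mathcomp Require Import all_boot all_order all_algebra.
From mathcomp Require Import all_classical all_reals all_analysis.
Set Implicit Arguments.
Unset Strict Implicit.
Unset Printing Implicit Defensive.
Import Order.TTheory GRing.Theory Num.Theory.
Import numFieldNormedType.Exports.
Local Open Scope ring_scope.

(* Loops are not excluded: [u x - u x = 0] makes them invisible to the
   operators below, so simple graphs are a special case. *)
Record wgraph (R : realType) (V : finType) := WGraph {
  adj : rel V;
  wt : V -> V -> R;
  mu : V -> R;
  adj_sym : symmetric adj;
  adj_connected : forall x y : V, connect adj x y;
  wt_ge0 : forall x y : V, 0 <= wt x y;
  wt_sym : forall x y : V, wt x y = wt y x;
  wt_eq0 : forall x y : V, wt x y = 0 <-> ~~ adj x y;
  mu_gt0 : forall x : V, 0 < mu x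
}.

Section Operators.
Variables (R : realType) (V : finType) (G : wgraph R V).
Implicit Types (b c u : V -> R) (f : V -> R -> R) (x y : V).

Definition laplacian u x : R :=
  \sum_(y : V) (u y - u x) * (wt G y x / mu G x).

(* The [y]-component of the gradient of [u] at [x], meaningful for [y ~ x]. *)
Definition grad u x y : R :=
  (u y - u x) * Num.sqrt (wt G x y / (2 * mu G x)).

(* The coefficient of the [y]-component is [b y], not [b x]. *)
Definition bgrad b u x : R := \sum_(y : V | adj G x y) b y * grad u x y.

Definition elliptic b c u x : R :=
  - laplacian u x - bgrad b u x + c x * u x.

Definition solution b c f u : Prop :=
  forall x, elliptic b c u x = f x (u x).

Definition upper_solution b c f u : Prop :=
  forall x, elliptic b c u x >= f x (u x).

Definition lower_solution b c f u : Prop :=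
  forall x, elliptic b c u x <= f x (u x).

End Operators.

(* Seeding the iterated min (max) with a value of [u] makes it the actual
   minimum (maximum) of [u], whichever vertex [x0] is chosen. *)
Definition minV (R : realType) (V : finType) (x0 : V) (u : V -> R) : R :=
  \big[Order.min/u x0]_(x : V) u x.

Definition maxV (R : realType) (V : finType) (x0 : V) (u : V -> R) : R :=
  \big[Order.max/u x0]_(x : V) u x.

(* Main.v *)
Require Import Defs.
From HB Require Import structures.
From mathcomp Require Import all_boot all_order all_algebra.
From mathcomp Require Import all_classical all_reals all_analysis.
From mathcomp Require Import ring lra.
Set Implicit Arguments.
Unset Strict Implicit.
Unset Printing Implicit Defensive.
Import Order.TTheory GRing.Theory Num.Theory.
Import numFieldNormedType.Exports.
Local Open Scope classical_set_scope.
Local Open Scope ring_scope.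

(** Moving the [u x] terms of (P) to one side, the operator reads
    [D x * u x - \sum_y a x y * u y], where the sign condition on [b] makes every
    weight [a x y] nonnegative.  Hence for a large constant [K]
    the damped Jacobi step
      [T u x = u x + (f x (u x) - elliptic u x) / K]
    is order preserving between the lower and the upper solution
    ([jacobi_step_monotone]): the diagonal term [D x] and the Lipschitz constant
    of [f] are both absorbed by [K].  This replaces the usual inversion of the
    linear operator and the accompanying maximum principle.

    The fixed points of [T] are exactly the solutions of (P), and lower (upper)
    solutions are the functions that [T] moves up (down).  So iterating [T] from
    the lower solution gives a nondecreasing sequence trapped in the order
    interval; it converges pointwise, its limit is fixed since [T] is
    continuous, and every fixed point of the interval stays above all the
    iterates, hence above the limit ([least_fixed_point_iteration]).  The
    maximal solution is the minimal one for the reflected map [w |-> - T (- w)]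
    ([greatest_fixed_point_iteration]).  The two sequences never cross, because
    the minimal solution lies below the maximal one and separates them. *)

(** * Monotone iteration in an order interval of functions *)

Section MonotoneIteration.
Variables (R : realType) (V : Type).
Implicit Types (u v w l h : V -> R) (T : (V -> R) -> V -> R).

Definition lef u v := forall x, u x <= v x.

Definition order_interval l h u := lef l u /\ lef u h.

Definition monotone_on l h T :=
  forall u v, lef l u -> lef u v -> lef v h -> lef (T u) (T v).

Definition seq_continuous_on l h T :=
  forall (s : nat -> V -> R) u, (forall m, order_interval l h (s m)) ->
    order_interval l h u ->
    (forall x, s m x @[m --> \oo] --> u x) ->
    forall x, T (s m) x @[m --> \oo] --> T u x.

Lemma lef_trans u v w : lef u v -> lef v w -> lef u w.
Proof. by move=> uv vw x; apply: le_trans (uv x) (vw x). Qed.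

(** The iterates [T^m l] increase because the first step does and [T] is
    monotone; they stay below [h], and below any fixed point, because these are
    moved down (weakly) by [T].  Completeness of [R] gives the pointwise limit,
    and continuity of [T] along the sequence makes it a fixed point. *)
Lemma least_fixed_point_iteration l h T :
  monotone_on l h T -> seq_continuous_on l h T ->
  lef l h -> lef l (T l) -> lef (T h) h ->
  exists (s : nat -> V -> R) w,
    [/\ forall m n, (m <= n)%N -> lef (s m) (s n),
        forall m, lef l (s m) /\ lef (s m) w,
        forall x, s m x @[m --> \oo] --> w x,
        order_interval l h w /\ (forall x, T w x = w x) &
        forall u, order_interval l h u -> (forall x, T u x = u x) -> lef w u].
Proof.
move=> Tmono Tcont lh lT Th.
pose s m := iter m T l.
have sP m : [/\ lef l (s m), lef (s m) (s m.+1) & lef (s m.+1) h].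
  elim: m => [|m [ls ss sh]]; rewrite /s /=.
    by split=> //; apply: lef_trans Th; apply: Tmono.
  have ls1 := lef_trans ls ss; split=> //; first exact: Tmono.
  by apply: lef_trans Th; apply: Tmono.
have ls m : lef l (s m) by case: (sP m).
have sh m : lef (s m) h by case: (sP m) => _ ? ?; apply: lef_trans; eassumption.
have smono m n : (m <= n)%N -> lef (s m) (s n).
  move=> mn x; have step k : s k x <= s k.+1 x by case: (sP k).
  exact: (nondecreasing_seqP _).1 step _ _ mn.
have sx_mono x : {homo (s ^~ x) : n m / (n <= m)%N >-> n <= m}.
  by move=> m n mn; exact: smono.
have scvg x : cvgn (s ^~ x).
  apply: nondecreasing_is_cvgn => //.
  by exists (h x) => _ [m _ <-]; exact: sh.
pose w x := limn (s ^~ x).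
have sw m : lef (s m) w by move=> x; exact: nondecreasing_cvgn_le.
have wle u : (forall m, lef (s m) u) -> lef w u.
  by move=> su x; apply: limr_le => //; near=> m; exact: su.
have lw : lef l w := sw 0.
have wbox : order_interval l h w by split=> //; exact: wle.
have sbox m : order_interval l h (s m) by [].
exists s, w; split=> //.
- split=> // x.
  (* [T (s m)] is the shifted sequence, so its limit is also [w]. *)
  apply: (@cvg_unique _ _ (s m.+1 x @[m --> \oo])) => //.
    exact: (Tcont s w).
  by have := scvg x; rewrite -(cvg_shiftS (s ^~ x)).
- move=> u [lu uh] Tu; apply: wle; elim=> [|m IHm] //=.
  by move=> x; rewrite -(Tu x); exact: Tmono.
Unshelve. all: by end_near. Qed.

Lemma oppfK u : \- (\- u) = u.
Proof. by apply/funext => x /=; rewrite opprK. Qed.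

Lemma lefN u v : lef u v -> lef (\- v) (\- u).
Proof. by move=> uv x; rewrite lerN2. Qed.

Lemma lefNl u v : lef (\- u) v -> lef (\- v) u.
Proof. by move=> /lefN; rewrite oppfK. Qed.

Lemma lefNr u v : lef u (\- v) -> lef v (\- u).
Proof. by move=> /lefN; rewrite oppfK. Qed.

Lemma order_intervalN l h u :
  order_interval (\- h) (\- l) u -> order_interval l h (\- u).
Proof. by move=> [hu ul]; split; [exact: lefNr | exact: lefNl]. Qed.

(** Reflection [u |-> - u] turns [T] into [w |-> - T (- w)] and exchanges the
    ends of the interval, so least fixed points become greatest ones. *)
Lemma greatest_fixed_point_iteration l h T :
  monotone_on l h T -> seq_continuous_on l h T ->
  lef l h -> lef l (T l) -> lef (T h) h ->
  exists (s : nat -> V -> R) w,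
    [/\ forall m n, (m <= n)%N -> lef (s n) (s m),
        forall m, lef w (s m) /\ lef (s m) h,
        forall x, s m x @[m --> \oo] --> w x,
        order_interval l h w /\ (forall x, T w x = w x) &
        forall u, order_interval l h u -> (forall x, T u x = u x) -> lef u w].
Proof.
move=> Tmono Tcont lh lT Th; pose T' w := \- T (\- w).
have Tmono' : monotone_on (\- h) (\- l) T'.
  move=> u v hu uv vl; apply: lefN; apply: Tmono.
  - exact: lefNr.
  - exact: lefN.
  - exact: lefNl.
have Tcont' : seq_continuous_on (\- h) (\- l) T'.
  move=> s u sbox ubox su x; apply: cvgN.
  apply: (Tcont (fun m => \- s m)) => [m||y].
  - exact: order_intervalN.
  - exact: order_intervalN.
  - exact: cvgN.
have lT' : lef (\- h) (T' (\- h)) by rewrite /T' oppfK; exact: lefN.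
have Th' : lef (T' (\- l)) (\- l) by rewrite /T' oppfK; exact: lefN.
have [s [w [smono sb scvg [wbox Tw] wmin]]] :=
  least_fixed_point_iteration Tmono' Tcont' (lefN lh) lT' Th'.
exists (fun m => \- s m), (\- w); split.
- by move=> m n mn; apply: lefN; exact: smono.
- by move=> m; have [hs sw] := sb m; split; [exact: lefN | exact: lefNl].
- by move=> x; apply: cvgN.
- split; first exact: order_intervalN.
  by move=> x /=; rewrite -[in RHS]Tw /T' opprK.
- move=> u ubox Tu; apply: lefNr; apply: wmin.
    by apply: order_intervalN; rewrite !oppfK.
  by move=> x; rewrite /T' oppfK /= Tu.
Qed.

End MonotoneIteration.

(** * The damped Jacobi step of the equation *)

Section JacobiStep.
Variables (R : realType) (V : finType) (G : wgraph R V).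
Variables (b c : V -> R) (f : V -> R -> R).
Implicit Types (u v w l h : V -> R) (x y : V).

(** The coefficient of [u x] in [elliptic G b c u x]. *)
Definition elliptic_diag x : R :=
  \sum_y (wt G y x / mu G x)
  + \sum_(y | adj G x y) (b y * Num.sqrt (wt G x y / (2 * mu G x))) + c x.

Lemma ellipticB u v x :
  elliptic G b c (u \- v) x = elliptic G b c u x - elliptic G b c v x.
Proof.
rewrite /elliptic.
have -> : laplacian G (u \- v) x = laplacian G u x - laplacian G v x.
  by rewrite /laplacian -sumrB; apply: eq_bigr => y _ /=; ring.
have -> : bgrad G b (u \- v) x = bgrad G b u x - bgrad G b v x.
  by rewrite /bgrad -sumrB; apply: eq_bigr => y _; rewrite /grad /=; ring.
by rewrite /=; ring.
Qed.

(** Discarding the neighbours' contribution can only increase the value, since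
    [b], the weights and [w] are all nonnegative. *)
Lemma elliptic_le_diag w x : (forall y, 0 <= b y) -> (forall y, 0 <= w y) ->
  elliptic G b c w x <= elliptic_diag x * w x.
Proof.
move=> b0 w0.
have lapl : - laplacian G w x <= (\sum_y (wt G y x / mu G x)) * w x.
  rewrite /laplacian -sumrN mulr_suml; apply: ler_sum => y _.
  have := mulr_ge0 (w0 y) (divr_ge0 (wt_ge0 G y x) (ltW (mu_gt0 G x))); lra.
have bgr : - bgrad G b w x <=
    (\sum_(y | adj G x y) (b y * Num.sqrt (wt G x y / (2 * mu G x)))) * w x.
  rewrite /bgrad -sumrN mulr_suml; apply: ler_sum => y _; rewrite /grad.
  have q_ge0 := sqrtr_ge0 (wt G x y / (2 * mu G x)).
  rewrite mulrBl mulrBr opprB [w x * _]mulrC [b y * (_ * w x)]mulrA.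
  by rewrite gerDl oppr_le0 !mulr_ge0.
by rewrite /elliptic /elliptic_diag 2!mulrDl lerD2r lerD.
Qed.

Definition lipschitz_on l h (M : R) := forall x p q,
  l x <= p <= h x -> l x <= q <= h x -> `|f x p - f x q| <= M * `|p - q|.

Definition jacobi_step (K : R) u x : R :=
  u x + (f x (u x) - elliptic G b c u x) / K.

Lemma jacobi_step_fixed K u : K != 0 ->
  (forall x, jacobi_step K u x = u x) <-> solution G b c f u.
Proof.
move=> K0; split=> [Tu x | solu x]; last first.
  by rewrite /jacobi_step solu subrr mul0r addr0.
have /eqP := Tu x; rewrite /jacobi_step -subr_eq0 addrAC subrr add0r.
by rewrite mulf_eq0 invr_eq0 (negbTE K0) orbF subr_eq0 => /eqP ->.
Qed.

Lemma lef_jacobi_step K u : 0 < K -> lower_solution G b c f u ->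
  lef u (jacobi_step K u).
Proof. by move=> K0 lu x; rewrite lerDl divr_ge0 ?subr_ge0 // ltW. Qed.

Lemma jacobi_step_lef K u : 0 < K -> upper_solution G b c f u ->
  lef (jacobi_step K u) u.
Proof.
by move=> K0 uu x; rewrite gerDl pmulr_lle0 ?invr_gt0 // subr_le0.
Qed.

(** Raising [u] to [v] changes [K * T u x] by at least
    [(K - elliptic_diag x - M) * (v x - u x)]: linearity reduces the operator
    term to [v - u >= 0], where [elliptic_le_diag] applies. *)
Lemma jacobi_step_monotone l h M K : (forall y, 0 <= b y) ->
  lipschitz_on l h M -> 0 < K -> (forall x, elliptic_diag x + M <= K) ->
  monotone_on l h (jacobi_step K).
Proof.
move=> b0 lip K0 DK u v lu uv vh x.
have uv0 y : 0 <= (v \- u) y by rewrite subr_ge0.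
have := elliptic_le_diag x b0 uv0; rewrite ellipticB /= => ell.
have fuv : f x (u x) - f x (v x) <= M * (v x - u x).
  apply: le_trans (ler_norm _) _.
  have -> : v x - u x = `|u x - v x| by rewrite distrC (ger0_norm (uv0 x)).
  apply: lip.
    by rewrite lu (le_trans (uv x)).
  by rewrite vh (le_trans (lu x)).
have := mulr_ge0 (uv0 x) (_ : 0 <= K - elliptic_diag x - M).
rewrite -addrA -opprD subr_ge0 => /(_ (DK x)) /= key.
rewrite -(ler_pM2l K0) /jacobi_step !mulrDr ![K * (_ / K)]mulrC !divfK ?gt_eqF //.
lra.
Qed.

Lemma elliptic_cvg (s : nat -> V -> R) u :
  (forall x, s m x @[m --> \oo] --> u x) ->
  forall x, elliptic G b c (s m) x @[m --> \oo] --> elliptic G b c u x.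
Proof.
move=> su x; apply: cvgD; last by apply: cvgM; [exact: cvg_cst | exact: su].
apply: cvgB; first apply: cvgN.
  apply: cvg_big => [|y _]; first exact: add_continuous.
  by apply: cvgM; [apply: cvgB; exact: su | exact: cvg_cst].
apply: cvg_big => [|y _]; first exact: add_continuous.
apply: cvgM; first exact: cvg_cst.
by apply: cvgM; [apply: cvgB; exact: su | exact: cvg_cst].
Qed.

(** The operator is a finite sum of coordinates; the Lipschitz bound handles [f],
    of which nothing is assumed outside the order interval. *)
Lemma jacobi_step_continuous l h M K :
  lipschitz_on l h M -> seq_continuous_on l h (jacobi_step K).
Proof.
move=> lip s u sbox [lu uh] su x.
apply: cvgD; first exact: su.
apply: cvgM; last exact: cvg_cst.
apply: cvgB; last exact: elliptic_cvg.
apply/subr_cvg0/norm_cvg0P.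
apply: (@squeeze_cvgr _ _ _ _ (fun=> 0) (fun m => M * `|s m x - u x|)).
- near=> m; rewrite normr_ge0 /=; have [ls sh] := sbox m.
  by apply: lip; rewrite ?ls ?sh ?lu ?uh.
- exact: cvg_cst.
- rewrite -(mulr0 M) -(@normr0 _ R); apply: cvgM; first exact: cvg_cst.
  by apply: cvg_norm; apply/subr_cvg0; exact: su.
Unshelve. all: by end_near. Qed.

Lemma jacobi_damping_exists M :
  exists2 K : R, 0 < K & forall x, elliptic_diag x + M <= K.
Proof.
exists (\sum_x `|elliptic_diag x| + `|M| + 1).
  by rewrite ltr_wpDl // addr_ge0 // sumr_ge0.
move=> x; rewrite (bigD1 x) //=.
have := @sumr_ge0 _ _ (index_enum V) (fun i => i != x)
  (fun i => `|elliptic_diag i|) (fun i _ => normr_ge0 _).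
have := ler_norm (elliptic_diag x); have := ler_norm M; lra.
Qed.

End JacobiStep.

Theorem theorem4p7 (R : realType) (V : finType) (x0 : V) (G : wgraph R V)
  (b c : V -> R) (f : V -> R -> R) (uup ulow : V -> R) (M' : R) :
  (forall x : V, 0 <= b x) ->
  upper_solution G b c f uup ->
  lower_solution G b c f ulow ->
  (forall x : V, ulow x <= uup x) ->
  0 < M' ->
  (forall (x : V) (u v : R),
     u \in `[minV x0 ulow, maxV x0 uup] ->
     v \in `[minV x0 ulow, maxV x0 uup] ->
     `|f x u - f x v| <= M' * `|u - v|) ->
  exists (lo up : nat -> V -> R) (umin umax : V -> R),
    (forall m n : nat, (1 <= m)%N -> (m <= n)%N ->
       forall x : V, lo m x <= lo n x) /\
    (forall m n : nat, (1 <= m)%N -> (m <= n)%N ->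
       forall x : V, up n x <= up m x) /\
    (forall m : nat, (1 <= m)%N -> forall x : V,
       ulow x <= lo m x /\ lo m x <= up m x /\ up m x <= uup x) /\
    (forall x : V, (fun m : nat => lo m x) @ \oo --> umin x) /\
    (forall x : V, (fun m : nat => up m x) @ \oo --> umax x) /\
    solution G b c f umin /\
    solution G b c f umax /\
    (forall u : V -> R, solution G b c f u ->
       (forall x : V, ulow x <= u x /\ u x <= uup x) ->
       forall x : V, umin x <= u x /\ u x <= umax x).
Proof.
move=> b0 upper lower lu _ lipI.
have lip : lipschitz_on f ulow uup M'.
  have box x p : ulow x <= p <= uup x -> p \in `[minV x0 ulow, maxV x0 uup].
    move=> /andP[lp pu]; rewrite in_itv /=; apply/andP; split.
      exact: le_trans (bigmin_le _ _ _) lp.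
    exact: le_trans pu (le_bigmax _ _ _).
  by move=> x p q px qx; apply: lipI; exact: (box x).
have [K K0 DK] := jacobi_damping_exists G b c M'.
have Tmono := jacobi_step_monotone b0 lip K0 DK.
have Tcont := jacobi_step_continuous (G := G) (b := b) (c := c) (K := K) lip.
have Tl := lef_jacobi_step K0 lower.
have Tu := jacobi_step_lef K0 upper.
have fixedP u := jacobi_step_fixed G b c f u (lt0r_neq0 K0).
have [lo [umin [lo_mono lo_b lo_cvg [min_box min_fix] minP]]] :=
  least_fixed_point_iteration Tmono Tcont lu Tl Tu.
have [up [umax [up_mono up_b up_cvg [max_box max_fix] maxP]]] :=
  greatest_fixed_point_iteration Tmono Tcont lu Tl Tu.
have min_max : lef umin umax by exact: minP.
exists lo, up, umin, umax; split; first by move=> m n _; exact: lo_mono.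
split; first by move=> m n _ mn; exact: up_mono.
split=> [m _ x|].
  (* The minimal and maximal solutions separate the two sequences. *)
  have [[lo_ge lo_le] [up_ge up_le]] := (lo_b m, up_b m).
  split; first exact: lo_ge.
  by split; [exact: (lef_trans lo_le (lef_trans min_max up_ge) x) | exact: up_le].
split=> //; split=> //; split; first exact/fixedP.
split; first exact/fixedP.
move=> u /fixedP u_fix u_box x.
have {}u_box : order_interval ulow uup u by split=> y; case: (u_box y).
by split; [exact: minP | exact: maxP].
Qed.
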